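(* Let $D\subset\mathbb{R}^n$ be a bounded domain with $0\in D$ and $m(\partial D)=0$, where $m$ is Lebesgue measure. For $k\ge1$ let $X^k$ be the linearly interpolated discrete-time simple random walk on $D_k$, stepping every $2^{-2k}$ units of time, and let $\mathbf{P}^k_{m_k}$ be its law with initial distribution $m_k$. Then the laws $\{\mathbf{P}^k_{m_k},k\ge1\}$ of $\{X^k,k\ge1\}$ are tight in the space $C([0,T],\mathbb{R}^n)$ for every $T>0$.
   Context: A domain is a connected open set. Initial distributions are finite measures, not necessarily of total mass 1; $\mathbf{P}^k_\mu=\int \mathbf{P}^k_x\,\mu(dx)$. $C([0,T],\mathbb{R}^n)$ carries the uniform topology. Lattice: let $\overline{2^{-k}\mathbb{Z}^n}$ be the union of all closed line segments joining nearest neighbors in $2^{-k}\mathbb{Z}^n$, $D_k^*$ the connected component of $\overline{2^{-k}\mathbb{Z}^n}\cap D$ containing $0$, and $D_k=D_k^*\cap 2^{-k}\mathbb{Z}^n$. For $x,y\in D_k$ write $x\leftrightarrow y$ if $|x-y|=2^{-k}$; $v_k(x)$ is the degree of $x$, i.e. the number of $y\in D_k$ with $y\leftrightarrow x$. The measure $m_k$ on $D_k$ is $m_k(\{x\})=\frac{v_k(x)}{2n}2^{-kn}$. (If $D_k=\{0\}$, which can happen only for finitely many $k$, then $m_k=0$ and the walk is taken to stay at $0$.) Random walk: $\{X^k_{j2^{-2k}},j=0,1,\dots\}$ is the Markov chain on $D_k$ that at each step moves from $x$ to one of its $v_k(x)$ neighbors with equal probabilities; $X^k_t$ for all $t\ge0$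 is obtained by linear interpolation over the intervals $((j-1)2^{-2k},j2^{-2k})$. $\mathbf{P}^k_x$ is its law with $X^k_0=x$. *)

(* Defs.v *)
From HB Require Import structures.
From mathcomp Require Import all_boot all_order all_algebra.
From mathcomp Require Import finmap.
From mathcomp Require Import all_classical all_reals all_analysis.

Set Implicit Arguments.
Unset Strict Implicit.
Unset Printing Implicit Defensive.

Import Order.TTheory GRing.Theory Num.Theory.
Import numFieldNormedType.Exports.

Local Open Scope classical_set_scope.
Local Open Scope ring_scope.

Section Euclidean.
Context (R : realType) (n : nat).
Local Notation V := 'rV[R]_n.

(* The library norm on matrices is the sup norm; its topology and bounded sets
   are the Euclidean ones, but the neighbour relation on a lattice is not. *)
Definition enorm (x : V) : R := Num.sqrt (\sum_i x ord0 i ^+ 2).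

Definition boundary (A : set V) : set V := closure A `\` A°.

Definition segment (x y : V) : set V :=
  [set (1 - t) *: x + t *: y | t in `[0, 1]].

Definition box (a b : V) : set V :=
  [set x | forall i, a ord0 i <= x ord0 i <= b ord0 i].

Definition box_volume (a b : V) : R := \prod_i (b ord0 i - a ord0 i).

(* n-dimensional Lebesgue measure, as the outer measure given by countable
   covers by boxes; the Lebesgue measure is its restriction to measurable sets,
   in particular to closed sets such as boundaries. *)
Definition lebesgue_outer (A : set V) : \bar R :=
  ereal_inf [set (\sum_(0 <= i <oo) (box_volume (ab i).1 (ab i).2)%:E)%E
            | ab in [set ab : nat -> V * V |
                (forall i j, (ab i).1 ord0 j <= (ab i).2 ord0 j) /\
                A `<=` \bigcup_i box (ab i).1 (ab i).2]].

End Euclidean.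

Section Lattice.
Context (R : realType) (n : nat).
Local Notation V := 'rV[R]_n.

Definition lattice (k : nat) : set V :=
  [set x | forall i, exists z : int, x ord0 i = z%:~R * 2 ^- k].

Definition adjacent (k : nat) (x y : V) : Prop := enorm (x - y) = 2 ^- k.

Definition lattice_edges (k : nat) : set V :=
  \bigcup_(e in [set e : V * V |
      [/\ lattice k e.1, lattice k e.2 & adjacent k e.1 e.2]])
    segment e.1 e.2.

Definition Dstar (D : set V) (k : nat) : set V :=
  connected_component (lattice_edges k `&` D) 0.

Definition Dlat (D : set V) (k : nat) : set V := Dstar D k `&` lattice k.

(* The edge between two adjacent points of D_k is not required to lie in D. *)
Definition neighbors (D : set V) (k : nat) (x : V) : set V :=
  [set y | Dlat D k y /\ adjacent k x y].

Definition degree (D : set V) (k : nat) (x : V) : nat :=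
  #|` fset_set (neighbors D k x)|%fset.

(* m_k({x}) *)
Definition mk_mass (D : set V) (k : nat) (x : V) : R :=
  (degree D k x)%:R / (2 * n)%:R * 2 ^- (k * n).

(* A point of degree 0 exists only if D_k = {0}; the walk then stays there. *)
Definition step_prob (D : set V) (k : nat) (x y : V) : R :=
  if degree D k x == 0 then (y == x)%:R
  else if `[< neighbors D k x y >] then (degree D k x)%:R^-1 else 0.

End Lattice.

Section Walk.
Context (R : realType) (n : nat).
Local Notation V := 'rV[R]_n.

(* X_0, X_1, ... is, under each P_x with x in S, a Markov chain on the countable
   state space S, started at x, with one-step transition probabilities p. *)
Record markov_chain d (Omega : measurableType d) (S : set V) (p : V -> V -> R)
    (P : V -> probability Omega R) (X : nat -> Omega -> V) : Prop := {
  chain_state : forall j w, S (X j w) ;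
  chain_measurable : forall j y, measurable (X j @^-1` [set y]) ;
  chain_init : forall x, S x -> P x (X 0%N @^-1` [set x]) = 1%E ;
  chain_step : forall x, S x -> forall (N : nat) (s : nat -> V),
    (P x [set w | forall j, (j <= N.+1)%N -> X j w = s j] =
     P x [set w | forall j, (j <= N)%N -> X j w = s j]
       * (p (s N) (s N.+1))%:E)%E }.

(* The measure \int P_x(A) mu(dx), where mu is the measure on the countable set
   S with mu({x}) = m x. *)
Definition mixture d (Omega : measurableType d) (S : set V) (m : V -> R)
    (P : V -> probability Omega R) (A : set Omega) : \bar R :=
  (\esum_(x in S) ((m x)%:E * P x A))%E.

(* Linear interpolation of the sequence x, with x j placed at time j 2^(-2k). *)
Definition interpolate (k : nat) (x : nat -> V) (t : R) : V :=
  let s := t * 2 ^+ (2 * k) in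
  let j := Num.truncn s in
  x j + (s - j%:R) *: (x j.+1 - x j).

End Walk.

Section PathSpace.
Context (R : realType) (n : nat).
Local Notation V := 'rV[R]_n.

Definition path_space (T : R) : Type := continuousType (set_type `[0, T]) V.

HB.instance Definition _ (T : R) := Choice.on (path_space T).

(* The topology of uniform convergence on [0, T]. *)
HB.instance Definition _ (T : R) := Uniform.copy (path_space T)
  (initial_topology
    (fun f : path_space T => (f : {uniform set_type `[0, T] -> V}))).

Lemma interpolateE (k : nat) (x : nat -> V) (t : R) (N : nat) :
  let s := t * 2 ^+ (2 * k) in
  0 <= s -> (Num.truncn s < N)%N ->
  interpolate k x t =
    x 0%N + \sum_(j < N) Num.max 0 (Num.min 1 (s - j%:R)) *: (x j.+1 - x j).
Proof.
move=> s s0 mN; rewrite /interpolate -/s; set m := Num.truncn s.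
have /andP[ms sm] : m%:R <= s < m.+1%:R by exact: truncn_itv.
have key M : \sum_(j < M) Num.max 0 (Num.min 1 (s - j%:R)) *: (x j.+1 - x j)
    = (if (M <= m)%N then x M else x m + (s - m%:R) *: (x m.+1 - x m)) - x 0%N.
  elim: M => [|M IH]; first by rewrite big_ord0 leq0n subrr.
  rewrite big_ord_recr /= IH.
  have [Mm|mM|->] := ltngtP M m.
  - have h : 1 <= s - M%:R.
      by rewrite lerBrDr addrC natr1 (le_trans _ ms)// ler_nat.
    rewrite min_l// max_r// scale1r.
    by rewrite addrC addrA subrK.
  - have h : s - M%:R <= 0.
      by rewrite subr_le0 (le_trans (ltW sm))// ler_nat.
    by rewrite min_r ?(le_trans h)// max_l// scale0r addr0.
  - have h : s - m%:R <= 1 by rewrite lerBlDr addrC natr1 ltW.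
    by rewrite min_r// max_r ?subr_ge0// addrAC.
by rewrite key leqNgt mN /= [RHS]addrC subrK.
Qed.

Lemma continuous_interpolate (k : nat) (T : R) (x : nat -> V) :
  continuous (fun t : set_type `[0, T] => interpolate k x (set_val t)).
Proof.
pose c : R := 2 ^+ (2 * k).
have c0 : 0 <= c by rewrite exprn_ge0.
pose N := (Num.truncn (T * c)).+1.
pose g (t : R) : V := x 0%N +
  \sum_(j < N) Num.max 0 (Num.min 1 (t * c - j%:R)) *: (x j.+1 - x j).
have -> : (fun t : set_type `[0, T] => interpolate k x (set_val t)) =
          g \o set_val.
  apply/funext => t /=.
  have : set_val t \in `[0, T]%classic by case: t => u; rewrite set_valE.
  rewrite inE /= in_itv /= => /andP[t0 tT].
  by apply: interpolateE; [exact: mulr_ge0|rewrite ltnS le_truncn ?ler_wpM2r].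
have gc : continuous g.
  move=> t; apply: cvgD; first exact: cvg_cst.
  rewrite {g}; elim: N => [|M IH].
    by under eq_fun do rewrite big_ord0; rewrite big_ord0; exact: cvg_cst.
  under eq_fun do rewrite big_ord_recr /=.
  rewrite big_ord_recr /=; apply: cvgD => //.
  apply: cvgZr_tmp.
  apply: (@continuous_max _ _ (fun=> 0) (fun u : R => Num.min 1 (u * c - M%:R))).
    exact: cvg_cst.
  apply: (@continuous_min _ _ (fun=> 1) (fun u : R => u * c - M%:R)).
    exact: cvg_cst.
  by apply: cvgB; [apply: cvgMr_tmp; exact: cvg_id|exact: cvg_cst].
move=> t; apply: continuous_comp; last exact: gc.
exact: initial_continuous.
Qed.

Definition interp_path (k : nat) (T : R) (x : nat -> V) : path_space T :=
  mkcts (@continuous_interpolate k T x).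

End PathSpace.

Definition tight (R : realType) (E : topologicalType) (I : Type) (J : set I)
    (mu : I -> set E -> \bar R) : Prop :=
  forall eps : R, 0 < eps ->
    exists2 K : set E, compact K & forall i, J i -> (mu i (~` K) <= eps%:E)%E.

(* Main.v *)
Require Import Defs.
From mathcomp Require Import all_boot all_order all_algebra.
From mathcomp Require Import finmap.
From mathcomp Require Import all_classical all_reals all_analysis.
From mathcomp Require Import ring lra zify.

Set Implicit Arguments.
Unset Strict Implicit.
Unset Printing Implicit Defensive.

Import Order.TTheory GRing.Theory Num.Theory.
Import numFieldNormedType.Exports.

Local Open Scope classical_set_scope.
Local Open Scope ring_scope.

(* The measure m_k is reversible for the walk, so each coordinate f of the path
   admits the Lyons-Zheng decomposition: up to an error of one step size,
   f(Y_b) - f(Y_a) is half the difference of a forward martingale and of a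
   martingale of the time-reversed path, both with increments at most twice the
   step size 2^-k.  Hence E|f(Y_b) - f(Y_a)|^4 <= C ((b - a) 4^-k)^2 uniformly
   in k, the total mass of m_k being bounded because D is.  Summing over the
   dyadic intervals of all levels l <= 2k, outside a set of mass O(B^-4) every
   increment over a dyadic time interval of length 2^-l is at most
   B (7/8)^l, where 7/8 is chosen since 1/2 < (7/8)^4.  Chaining turns this into
   a modulus of continuity that does not depend on k, and the paths with this
   modulus and bounded by a constant form a compact set. *)

(** * Fourth moments of a finite reversible chain *)

Lemma ler_of_eq (R : porderZmodType) (x y : R) : x = y -> x <= y.
Proof. by move->. Qed.

Lemma sum_tuple_cons (V : nmodType) (S : finType) (N : nat)
    (G : N.+1.-tuple S -> V) :
  \sum_t G t = \sum_x \sum_(t : N.-tuple S) G [tuple of x :: t].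
Proof.
rewrite pair_big /=.
rewrite (reindex (fun q : S * N.-tuple S => [tuple of q.1 :: q.2])) //=.
exists (fun t : N.+1.-tuple S => (thead t, [tuple of behead t])).
  by move=> [x t] _ /=; congr pair; apply/val_inj.
by move=> t _; rewrite [RHS]tuple_eta.
Qed.

Lemma big_nat_ord_cond (V : Type) (idx : V) (op : Monoid.law idx) (a b N : nat)
    (G : nat -> V) : (b <= N)%N ->
  \big[op/idx]_(a <= j < b) G j =
  \big[op/idx]_(j < N) (if (a <= j < b)%N then G j else idx).
Proof.
move=> bN; rewrite (big_nat_widen _ _ _ _ _ bN) (big_nat_widenl _ 0)// big_mkord.
by rewrite [LHS]big_mkcond; apply: eq_bigr => j _; rewrite /= andbC.
Qed.

Section FiniteChain.
Context (R : realFieldType) (S : finType) (x0 : S).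
Variables (m : S -> R) (p : S -> S -> R).
Hypothesis m_ge0 : forall x, 0 <= m x.
Hypothesis p_ge0 : forall x y, 0 <= p x y.
Hypothesis p_sum1 : forall x, \sum_y p x y = 1.
Hypothesis m_rev : forall x y, m x * p x y = m y * p y x.

Definition path_weight (N : nat) (s : nat -> S) : R :=
  m (s 0%N) * \prod_(j < N) p (s j) (s j.+1).

(** The unnormalised expectation of [F] over trajectories of [N] steps started from [m]. [nth x0]
    extends each tuple to all of [nat] by the constant [x0]. *)
Definition path_sum (N : nat) (F : (nat -> S) -> R) : R :=
  \sum_(t : N.+1.-tuple S) path_weight N (nth x0 t) * F (nth x0 t).

Lemma path_weight_ge0 N s : 0 <= path_weight N s.
Proof. by rewrite mulr_ge0// prodr_ge0. Qed.

Lemma ler_path_sum N F G : (forall s, F s <= G s) ->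
  path_sum N F <= path_sum N G.
Proof.
by move=> FG; apply: ler_sum => t _; rewrite ler_wpM2l ?path_weight_ge0.
Qed.

Lemma eq_path_weight N s s' : (forall j, (j <= N)%N -> s j = s' j) ->
  path_weight N s = path_weight N s'.
Proof.
move=> ss'; rewrite /path_weight ss'//; congr (_ * _).
by apply: eq_bigr => j _; rewrite !ss'// ltnW.
Qed.

(** Detailed balance carries the factor [m] along the trajectory, one step at a time, from its first
    point to its last. *)
Lemma path_weight_rev N s :
  path_weight N (fun j => s (N - j)%N) = path_weight N s.
Proof.
have rev M : m (s M) * \prod_(j < M) p (s j.+1) (s j) = path_weight M s.
  elim: M => [|M IH]; first by rewrite /path_weight !big_ord0.
  rewrite /path_weight !big_ord_recr /= [RHS]mulrA -/(path_weight M s) -IH.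
  by rewrite [LHS]mulrCA [RHS]mulrAC mulrC -m_rev.
rewrite -rev /path_weight subn0; congr (_ * _).
rewrite (reindex_inj rev_ord_inj) /=; apply: eq_bigr => j _.
have := ltn_ord j; move: (nat_of_ord j) => i iN.
by congr (p (s _) (s _)); lia.
Qed.

(** Reversing tuples permutes the trajectories and preserves their weights. [F] may look at times up
    to [N] only: past [N] the reversed tuple reads [x0], while [s (N - j)] is [s 0]. *)
Lemma path_sum_rev N F :
  (forall s s', (forall j, (j <= N)%N -> s j = s' j) -> F s = F s') ->
  path_sum N (fun s => F (fun j => s (N - j)%N)) = path_sum N F.
Proof.
move=> Fext; rewrite /path_sum.
have rev_inj : injective (fun t : N.+1.-tuple S => [tuple of rev t]).
  by apply: inv_inj => t; apply/val_inj/revK.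
rewrite (reindex_inj rev_inj) /=.
apply: eq_bigr => t _.
have E j : (j <= N)%N -> nth x0 (rev t) j = nth x0 t (N - j).
  by move=> jN; rewrite nth_rev size_tuple ?ltnS// subSS.
congr (_ * _); first by rewrite -[RHS]path_weight_rev; exact: eq_path_weight.
by apply: Fext => j jN; rewrite E ?leq_subr// subKn.
Qed.

Lemma path_prob_sum1 N x :
  \sum_(t : N.-tuple S)
    \prod_(j < N) p (nth x0 (x :: t) j) (nth x0 (x :: t) j.+1) = 1.
Proof.
elim: N x => [|N IH] x.
  rewrite (big_pred1 [tuple]) => [|t]; last by apply/esym/eqP; exact: tuple0.
  by rewrite big_ord0.
rewrite sum_tuple_cons -[RHS](p_sum1 x); apply: eq_bigr => y _.
under eq_bigr do rewrite big_ord_recl /=.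
by rewrite -mulr_sumr IH mulr1.
Qed.

Lemma path_sum1 N : path_sum N (fun=> 1) = \sum_x m x.
Proof.
rewrite /path_sum sum_tuple_cons; apply: eq_bigr => x _.
under eq_bigr do rewrite /path_weight /= mulr1.
by rewrite -mulr_sumr path_prob_sum1 mulr1.
Qed.

(** * Fourth moments of forward and backward martingales *)

Section Martingale.
Variables (f : S -> R) (h : R).
Hypothesis h_ge0 : 0 <= h.
Hypothesis f_step : forall x y, p x y != 0 -> `|f y - f x| <= h.

Definition drift (x : S) : R := \sum_y p x y * (f y - f x).

(** Martingale increment in the Doob decomposition of [f] along the chain, [drift] being the
    predictable part. *)
Definition mart_diff (x y : S) : R := f y - f x - drift x.

Lemma drift_le x : `|drift x| <= h.
Proof.
rewrite (le_trans (ler_norm_sum _ _ _))//.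
rewrite -[leRHS]mul1r -(p_sum1 x) mulr_suml ler_sum// => y _.
have [->|pxy] := eqVneq (p x y) 0; first by rewrite !mul0r normr0.
by rewrite normrM ger0_norm// ler_wpM2l// f_step.
Qed.

Lemma mart_diff_le x y : p x y != 0 -> `|mart_diff x y| <= 2 * h.
Proof.
move=> pxy; rewrite (le_trans (ler_normB _ _))// mulr_natl mulr2n.
by rewrite lerD ?drift_le ?f_step.
Qed.

Lemma mart_diff_mean x : \sum_y p x y * mart_diff x y = 0.
Proof.
under eq_bigr do rewrite mulrBr.
by rewrite sumrB -mulr_suml p_sum1 mul1r subrr.
Qed.

(** The mask [c] selects the steps of a time window, so that a window and its time reversal are both
    sums over the whole trajectory. *)
Definition mart_sum (N : nat) (c : nat -> bool) (s : nat -> S) : R :=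
  \sum_(j < N) (c j)%:R * mart_diff (s j) (s j.+1).

(** In the expansion of (a + z)^4 the term linear in z averages to zero and the cubic one is
    absorbed by 4 a z^3 <= 2 a^2 z^2 + 2 z^4, whence the coefficients 8 = 6 + 2 and 3 = 1 + 2. The
    terms in [b] and [e] stand for the bound on the steps that follow. *)
Lemma mart_moment_step (x : S) (a b e : R) : 0 <= b ->
  \sum_y p x y * ((a + mart_diff x y) ^+ 4 + b * (a + mart_diff x y) ^+ 2 + e)
  <= a ^+ 4 + (8 * (2 * h) ^+ 2 + b) * a ^+ 2
     + (3 * (2 * h) ^+ 4 + b * (2 * h) ^+ 2 + e).
Proof.
move=> b0; have [c cE] : exists c, c = 2 * h by eexists.
rewrite -cE.
(* A pointwise bound that keeps the term linear in the increment unestimated, so that it averages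
   out. *)
pose U y := a ^+ 4 + (8 * c ^+ 2 + b) * a ^+ 2 + (3 * c ^+ 4 + b * c ^+ 2 + e)
  + (4 * a ^+ 3 + 2 * a * b) * mart_diff x y.
apply: (@le_trans _ _ (\sum_y p x y * U y)).
  apply: ler_sum => y _.
  have [->|pxy] := eqVneq (p x y) 0; first by rewrite !mul0r.
  rewrite ler_wpM2l// /U; move: (mart_diff_le pxy); rewrite -cE.
  move: (mart_diff x y) => z zc.
  have z2 : z ^+ 2 <= c ^+ 2 by move: zc; rewrite ler_norml => /andP[]; nra.
  have az : a ^+ 2 * z ^+ 2 <= a ^+ 2 * c ^+ 2 by rewrite ler_wpM2l ?sqr_ge0.
  have z4 : z ^+ 4 <= c ^+ 4.
    by rewrite (exprM z 2 2) (exprM c 2 2) ler_sqr ?nnegrE ?sqr_ge0.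
  have bz : b * z ^+ 2 <= b * c ^+ 2 by rewrite ler_wpM2l.
  have := sqr_ge0 (z * (a - z)).
  nra.
rewrite /U; under eq_bigr do rewrite mulrDr (mulrCA (p x _) (_ + _)).
rewrite big_split /= -mulr_suml p_sum1 -mulr_sumr mart_diff_mean.
by rewrite mul1r mulr0 addr0.
Qed.

(* Starting from an arbitrary value a makes induction on the first step work: the
   term linear in the increment vanishes, whereas E[M^3] need not. *)
Lemma mart_sum_moment N c x a :
  \sum_(t : N.-tuple S)
     (\prod_(j < N) p (nth x0 (x :: t) j) (nth x0 (x :: t) j.+1))
     * (a + mart_sum N c (nth x0 (x :: t))) ^+ 4
  <= a ^+ 4 + (8 * (2 * h) ^+ 2 * (\sum_(j < N) c j)%N%:R) * a ^+ 2
     + 4 * (2 * h) ^+ 4 * (\sum_(j < N) c j)%N%:R ^+ 2.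
Proof.
elim: N c x a => [|N IH] c x a.
  rewrite (big_pred1 [tuple]) => [|t]; last by apply/esym/eqP; exact: tuple0.
  by rewrite /mart_sum !big_ord0 mul1r addr0 mulr0 mul0r expr0n mulr0 !addr0.
rewrite sum_tuple_cons /=.
set n := (\sum_(j < N) c j.+1)%N.
have -> : (\sum_(j < N.+1) c j = c 0%N + n)%N by rewrite big_ord_recl.
set e := 4 * (2 * h) ^+ 4 * n%:R ^+ 2.
set b := 8 * (2 * h) ^+ 2 * n%:R.
have b0 : 0 <= b by rewrite !mulr_ge0// exprn_ge0// mulr_ge0.
apply: (@le_trans _ _ (\sum_y p x y * ((a + (c 0%N)%:R * mart_diff x y) ^+ 4
     + b * (a + (c 0%N)%:R * mart_diff x y) ^+ 2 + e))).
  apply: ler_sum => y _.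
  under eq_bigr => t _.
    rewrite big_ord_recl /= /mart_sum big_ord_recl /= addrA -mulrA.
    over.
  rewrite -mulr_sumr ler_wpM2l//.
  exact: (IH (fun j => c j.+1) y (a + (c 0%N)%:R * mart_diff x y)).
case: (c 0%N); last first.
  under eq_bigr do rewrite mul0r addr0.
  by rewrite -mulr_suml p_sum1 mul1r add0n.
under eq_bigr do rewrite mul1r.
apply: (le_trans (mart_moment_step _ _ _ b0)).
have h4 : 0 <= (2 * h) ^+ 4 by rewrite exprn_ge0// mulr_ge0.
rewrite natrD (_ : (true : nat)%:R = 1)// /e /b -subr_ge0.
(* The slack is exactly one (2 h)^4, as 4 (n + 1)^2 = (4 n^2 + 8 n + 3) + 1. *)
rewrite (_ : _ - _ = (2 * h) ^+ 4)//; ring.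
Qed.

Lemma path_sum_mart N c :
  path_sum N (fun s => mart_sum N c s ^+ 4)
  <= 4 * (2 * h) ^+ 4 * (\sum_(j < N) c j)%N%:R ^+ 2 * \sum_x m x.
Proof.
rewrite /path_sum sum_tuple_cons mulr_sumr ler_sum// => x _.
under eq_bigr do rewrite /path_weight /= -mulrA.
rewrite -mulr_sumr [leRHS]mulrC ler_wpM2l//.
have := mart_sum_moment N c x 0.
rewrite !expr0n /= mulr0 !add0r; under eq_bigr do rewrite add0r.
exact.
Qed.

(** Lyons-Zheng: [mart_diff x y - mart_diff y x] equals 2 (f y - f x) + drift y - drift x, which
    telescopes along the path. The first terms form a forward martingale, the second ones a
    martingale of the reversed path. *)
Lemma increment_decomp N (a b : nat) s : (a <= b <= N)%N ->
  f (s b) - f (s a) =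
    (2^-1 * mart_sum N (fun j => (a <= j < b)%N) s
     - 2^-1 * mart_sum N (fun j => (N - b <= j < N - a)%N) (fun j => s (N - j)%N))
    + 2^-1 * (drift (s a) - drift (s b)).
Proof.
move=> /andP[ab bN].
(* The substitution j -> N - 1 - j turns the reversed window back into [a, b) and traverses every
   step backwards. *)
have -> : mart_sum N (fun j => (N - b <= j < N - a)%N) (fun j => s (N - j)%N)
    = \sum_(j < N) ((a <= j < b)%N)%:R * mart_diff (s j.+1) (s j).
  rewrite /mart_sum (reindex_inj rev_ord_inj) /=; apply: eq_bigr => j _.
  have := ltn_ord j; move: (nat_of_ord j) => i iN.
  by congr (_%:R * mart_diff (s _) (s _)); lia.
rewrite /mart_sum -mulrBr -mulrDr -sumrB.
have -> : \sum_(j < N) (((a <= j < b)%N)%:R * mart_diff (s j) (s j.+1)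
   - ((a <= j < b)%N)%:R * mart_diff (s j.+1) (s j)) =
   \sum_(a <= j < b)
      ((2 * f (s j.+1) + drift (s j.+1)) - (2 * f (s j) + drift (s j))).
  rewrite (big_nat_ord_cond _ _ _ bN); apply: eq_bigr => j _.
  by case: ifP => _; rewrite ?mul0r ?subrr// !mul1r /mart_diff; ring.
by rewrite telescope_sumr//; field.
Qed.

Lemma path_sum_increment N (a b : nat) : (a < b <= N)%N ->
  path_sum N (fun s => (f (s b) - f (s a)) ^+ 4)
  <= 243 * (b - a)%:R ^+ 2 * h ^+ 4 * \sum_x m x.
Proof.
move=> /andP[ab bN].
have c2716 : 0 <= 27 / 16 :> R by lra.
pose c j := (a <= j < b)%N; pose c' j := (N - b <= j < N - a)%N.
pose M := mart_sum N c; pose M' := mart_sum N c'.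
(* 243 = 108 + 108 + 27: the factor 27 comes from the inequality [three4], 1/16 from the halves in
   front of the two martingales, and 64 = 4 * 2^4 from their moment bound. *)
have -> : 243 * (b - a)%:R ^+ 2 * h ^+ 4 * \sum_x m x
  = 27 / 16 * (4 * (2 * h) ^+ 4 * (b - a)%:R ^+ 2 * \sum_x m x)
  + (27 / 16 * (4 * (2 * h) ^+ 4 * (b - a)%:R ^+ 2 * \sum_x m x)
  + 27 * h ^+ 4 * (b - a)%:R ^+ 2 * \sum_x m x) by field.
have cE : (\sum_(j < N) c j = b - a)%N.
  have := big_nat_ord_cond addn a (fun=> 1%N) bN.
  rewrite sum_nat_const_nat muln1 => ->.
  by apply: eq_bigr => j _; rewrite /c; case: ifP.
have c'E : (\sum_(j < N) c' j = b - a)%N.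
  have := big_nat_ord_cond addn (N - b)%N (fun=> 1%N) (leq_subr a N).
  rewrite sum_nat_const_nat muln1 (_ : N - a - (N - b) = b - a)%N; last by lia.
  by move=> ->; apply: eq_bigr => j _; rewrite /c'; case: ifP.
apply: (@le_trans _ _ (27 / 16 * path_sum N (fun s => M s ^+ 4)
   + (27 / 16 * path_sum N (fun s => M' (fun j => s (N - j)%N) ^+ 4)
      + 27 * h ^+ 4 * path_sum N (fun=> 1)))); last first.
  apply: lerD; first by rewrite ler_wpM2l// -cE path_sum_mart.
  apply: lerD.
    rewrite ler_wpM2l// -c'E (path_sum_rev (F := fun s => M' s ^+ 4)).
      exact: path_sum_mart.
    move=> s s' ss'; congr (_ ^+ 4); apply: eq_bigr => j _.
    by rewrite !ss'// ltnW.
  rewrite path_sum1 -!mulrA !ler_wpM2l ?exprn_ge0//.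
  (* The drift error is only of order h^4; it fits because (b - a)^2 >= 1. *)
  by rewrite mulrA ler_peMl ?sumr_ge0// -natrM ler1n muln_gt0 subn_gt0 ab.
rewrite /path_sum !mulr_sumr -!big_split /=; apply: ler_sum => t _.
set w := path_weight _ _.
rewrite !(mulrCA _ w) -!mulrDr ler_wpM2l ?path_weight_ge0//.
rewrite mulr1 (@increment_decomp N) ?(ltnW ab)//.
have := drift_le (nth x0 t a); have := drift_le (nth x0 t b).
rewrite -/M -/M'; move: (M _) (M' _) => u v.
rewrite !ler_norml; move: (drift _) (drift _) => y x /andP[y1 y2] /andP[x1 x2].
set z := 2^-1 * (y - x).
have zh : z ^+ 4 <= h ^+ 4.
  have z2 : z ^+ 2 <= h ^+ 2 by rewrite /z; nra.
  by rewrite (exprM z 2 2) (exprM h 2 2) ler_sqr ?nnegrE ?sqr_ge0.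
have three (q1 q2 q3 : R) :
    (q1 + q2 + q3) ^+ 2 <= 3 * (q1 ^+ 2 + q2 ^+ 2 + q3 ^+ 2).
  have := sqr_ge0 (q1 - q2); have := sqr_ge0 (q2 - q3); have := sqr_ge0 (q1 - q3).
  nra.
have three4 (q1 q2 q3 : R) :
    (q1 + q2 + q3) ^+ 4 <= 27 * (q1 ^+ 4 + q2 ^+ 4 + q3 ^+ 4).
  rewrite !(exprM _ 2 2).
  apply: (@le_trans _ _ ((3 * (q1 ^+ 2 + q2 ^+ 2 + q3 ^+ 2)) ^+ 2)).
    by rewrite ler_sqr ?nnegrE ?sqr_ge0// mulr_ge0// !addr_ge0 ?sqr_ge0.
  have := three (q1 ^+ 2) (q2 ^+ 2) (q3 ^+ 2).
  by rewrite exprMn; lra.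
have := three4 (2^-1 * u) (- (2^-1 * v)) z.
have -> : (2^-1 * u) ^+ 4 = u ^+ 4 / 16 by field.
have -> : (- (2^-1 * v)) ^+ 4 = v ^+ 4 / 16 by field.
by rewrite -/z; lra.
Qed.

End Martingale.

(** * Oscillation over dyadic time intervals of all levels *)

Lemma path_sum_sum N (I : Type) (r : seq I) (F : I -> (nat -> S) -> R) :
  path_sum N (fun s => \sum_(i <- r) F i s) = \sum_(i <- r) path_sum N (F i).
Proof.
by rewrite /path_sum exchange_big; apply: eq_bigr => t _; rewrite mulr_sumr.
Qed.

Lemma path_sumZ N a F : path_sum N (fun s => a * F s) = a * path_sum N F.
Proof. by rewrite /path_sum mulr_sumr; apply: eq_bigr => t _; rewrite mulrCA. Qed.

(* 1701 = 243 * 7, where 7 bounds the geometric series of ratio (8/7)^4 / 2. *)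
Lemma path_sum_oscillation (n K T1 : nat) (f : 'I_n -> S -> R) (h B : R)
    (G : (nat -> S) -> bool) :
  0 <= h -> h ^+ 2 * 2 ^+ K = 1 -> 0 < B ->
  (forall c x y, p x y != 0 -> `|f c y - f c x| <= h) ->
  (forall s, (forall c l i, (l <= K)%N -> (i < T1 * 2 ^ l)%N ->
      `|f c (s (i.+1 * 2 ^ (K - l))%N) - f c (s (i * 2 ^ (K - l))%N)|
         <= B * (7 / 8) ^+ l) -> ~~ G s) ->
  path_sum (T1 * 2 ^ K) (fun s => (G s)%:R)
  <= 1701 * n%:R * T1%:R / B ^+ 4 * \sum_x m x.
Proof.
move=> h0 hK B0 fstep Gosc.
have r0 : 0 < (7 / 8 : R) by lra.
have [rho rhoE] : exists rho : R, rho = (8 / 7) ^+ 4 by eexists.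
(* Markov's inequality for fourth powers: [term] is the fourth power of the increment divided by its
   threshold B (7/8)^l. *)
pose term c l i s : R := B ^- 4 * rho ^+ l *
  (f c (s (i.+1 * 2 ^ (K - l))%N) - f c (s (i * 2 ^ (K - l))%N)) ^+ 4.
have rho0 : 0 < rho by rewrite rhoE exprn_gt0//; lra.
have term_ge0 c l i s : 0 <= term c l i s.
  rewrite /term (exprM (_ - _) 2 2) mulr_ge0 ?sqr_ge0//.
  by rewrite mulr_ge0 ?invr_ge0 ?exprn_ge0 ?(ltW B0) ?(ltW rho0).
(* Union bound: when [G s] holds, some increment exceeds its threshold, and its term alone is at
   least 1. *)
apply: (@le_trans _ _ (path_sum (T1 * 2 ^ K) (fun s =>
   \sum_c \sum_(l < K.+1) \sum_(i < T1 * 2 ^ l) term c l i s))).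
  apply: ler_path_sum => s.
  have sum_ge0 c (l : 'I_K.+1) : 0 <= \sum_(i < T1 * 2 ^ l) term c l i s.
    by rewrite sumr_ge0.
  have sum2_ge0 c : 0 <= \sum_(l < K.+1) \sum_(i < T1 * 2 ^ l) term c l i s.
    by rewrite sumr_ge0.
  case: (boolP (G s)) => [Gs|_]; last by rewrite sumr_ge0.
  rewrite leNgt; apply/negP => lt1; move: Gs; apply/negP; apply: Gosc => c l i lK iT.
  rewrite leNgt; apply/negP => big; move: lt1; apply/negP; rewrite -leNgt.
  rewrite (bigD1 c)//= -[leLHS]addr0 lerD ?sumr_ge0//.
  rewrite (bigD1 (Ordinal (lK : (l < K.+1)%N)))//= -[leLHS]addr0 lerD ?sumr_ge0//;
    last by move=> ? _; exact: sumr_ge0.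
  rewrite (bigD1 (Ordinal iT))//= -[leLHS]addr0 lerD ?sumr_ge0//.
  rewrite /term; move: (_ - _) big => z big.
  have : (B * (7 / 8) ^+ l) ^+ 4 <= z ^+ 4.
    rewrite -[z ^+ 4]ger0_norm; last by rewrite (exprM z 2 2) sqr_ge0.
    rewrite normrX lerXn2r ?nnegrE// ?ltW//.
    by rewrite mulr_gt0// exprn_gt0.
  rewrite exprMn -exprM mulnC exprM => zB.
  rewrite -mulrA -[leLHS](mulVf (lt0r_neq0 (exprn_gt0 4 B0))).
  rewrite ler_wpM2l ?invr_ge0 ?exprn_ge0 ?(ltW B0)//.
  have <- : rho ^+ l * (B ^+ 4 * ((7 / 8) ^+ 4) ^+ l) = B ^+ 4.
    rewrite mulrCA -exprMn (_ : rho * _ = 1) ?expr1n ?mulr1//.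
    by rewrite rhoE; field.
  by rewrite ler_wpM2l// exprn_ge0// ltW.
apply: (le_trans (ler_of_eq (path_sum_sum _ _
  (fun c s => \sum_(l < K.+1) \sum_(i < T1 * 2 ^ l) term c l i s)))).
apply: (@le_trans _ _
  (\sum_(c < n) (1701 * T1%:R / B ^+ 4 * \sum_x m x))); last first.
  by rewrite sumr_const card_ord -[leLHS]mulr_natl; apply/ler_of_eq; ring.
apply: ler_sum => c _.
apply: (le_trans (ler_of_eq (path_sum_sum _ _
  (fun (l : 'I_K.+1) s => \sum_(i < T1 * 2 ^ l) term c l i s)))).
set mu := \sum_x m x.
have mu0 : 0 <= mu by rewrite sumr_ge0.
have Bi0 : 0 <= B ^- 4 by rewrite invr_ge0 exprn_ge0// ltW.
(* Level l has T1 2^l intervals, each contributing of order rho^l 4^-l. Hence the ratio q = rho / 2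
   = 2048/2401, for which 1 / (1 - q) < 7. *)
pose q : R := rho / 2.
apply: (@le_trans _ _
  (\sum_(l < K.+1) (243 * T1%:R / B ^+ 4 * mu * q ^+ l))); last first.
  rewrite -mulr_sumr -(big_mkord xpredT (fun l => q ^+ l)).
  have geo : \sum_(0 <= l < K.+1) q ^+ l <= 7.
    rewrite big_mkord; have := subrX1 q K.+1.
    have qK : 0 <= q ^+ K.+1 by rewrite exprn_ge0// /q divr_ge0// ltW.
    have qE : q = 4096 / 4802 by rewrite /q rhoE; field.
    by move: (q ^+ K.+1) (\sum_(i < _) _) qK => Q Z; rewrite qE; lra.
  have C0 : 0 <= 243 * T1%:R / B ^+ 4 * mu by rewrite !mulr_ge0.
  apply: (le_trans (ler_wpM2l C0 geo)).
  by apply/ler_of_eq; ring.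
apply: ler_sum => -[l lK] _ /=.
apply: (le_trans (ler_of_eq (path_sum_sum _ _
  (fun (i : 'I_(T1 * 2 ^ l)) s => term c l i s)))).
apply: (@le_trans _ _ (\sum_(i < T1 * 2 ^ l)
  (B ^- 4 * rho ^+ l * (243 * (2 ^- l) ^+ 2 * mu)))).
  apply: ler_sum => -[i iT] _ /=; rewrite path_sumZ ler_wpM2l//.
    by rewrite mulr_ge0// exprn_ge0// ltW.
  have iN : (i * 2 ^ (K - l) < i.+1 * 2 ^ (K - l) <= T1 * 2 ^ K)%N.
    rewrite ltn_pmul2r ?expn_gt0// leqnn /=.
    rewrite -[in leqRHS](subnKC (lK : l <= K)%N) expnD mulnA.
    by rewrite leq_pmul2r ?expn_gt0.
  (* The interval has 2^(K-l) steps, and h^2 2^K = 1 turns (2^(K-l))^2 h^4 into 4^-l. *)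
  apply: (le_trans (path_sum_increment h0 (fstep c) iN)).
  rewrite ler_wpM2r// -mulrA ler_wpM2l// -mulnBl subSnn mul1n natrX.
  rewrite (_ : h ^+ 4 = (h ^+ 2) ^+ 2); last by rewrite -exprM.
  rewrite -exprMn.
  apply/ler_of_eq; congr (_ ^+ 2).
  apply: (mulIf (lt0r_neq0 (exprn_gt0 l (ltr0n R 2)))).
  by rewrite mulVf ?expf_neq0 ?pnatr_eq0// mulrAC -exprD subnK// mulrC.
rewrite sumr_const card_ord -[leLHS]mulr_natl natrM natrX /q expr_div_n.
apply/ler_of_eq.
have : (2 : R) ^+ l != 0 by rewrite expf_neq0 ?pnatr_eq0.
move: (2 ^+ l) (rho ^+ l) => u v u0; field.
by rewrite u0 gt_eqF.
Qed.

End FiniteChain.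

(** * Chaining over dyadic times *)

Section Chaining.
Context (R : archiRealFieldType).
Variables (K T1 : nat) (B : R) (x : nat -> R).
Let r : R := 7 / 8.
Hypothesis B_ge0 : 0 <= B.
(** One unit of time is 2^K steps, so a dyadic interval of level l has 2^(K-l) steps. *)
Hypothesis dyadic_le : forall l i, (l <= K)%N -> (i < T1 * 2 ^ l)%N ->
  `|x (i.+1 * 2 ^ (K - l))%N - x (i * 2 ^ (K - l))%N| <= B * r ^+ l.

Let r_ge0 : 0 <= r. Proof. by rewrite /r; lra. Qed.

Let ler_Br l l' : (l <= l')%N -> B * r ^+ l' <= B * r ^+ l.
Proof. by move=> ll'; rewrite ler_wpM2l// ler_wiXn2l// /r; lra. Qed.

(** The binary digits of [a] below position q are cleared one at a time, the digit at position i
    costing at most B r^(K-i). The constant 7 is r / (1 - r), which makes the geometric sum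
    exact. *)
Lemma dyadic_floor_le q a : (q <= K)%N -> (a <= T1 * 2 ^ K)%N ->
  `|x a - x (a %/ 2 ^ q * 2 ^ q)%N| <= 7 * B * (r ^+ (K - q) - r ^+ K).
Proof.
move=> + aT; elim: q => [|q IH] qK.
  by rewrite expn0 divn1 muln1 subn0 !subrr normr0 mulr0.
move: (IH (ltnW qK)) => {IH}; set u := (a %/ 2 ^ q)%N => IH.
have rE : r ^+ (K - q) = r * r ^+ (K - q.+1) by rewrite -exprS; congr (_ ^+ _); lia.
have r1 : 7 * B * (r ^+ (K - q.+1) - r ^+ K)
    = 7 * B * (r ^+ (K - q) - r ^+ K) + B * r ^+ (K - q).
  by rewrite rE /r; field.
have Brq : 0 <= B * r ^+ (K - q) by rewrite mulr_ge0 ?exprn_ge0.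
rewrite expnSr divnMA -/u.
(* If u is even the two floors agree; if it is odd they are the ends of the dyadic interval that
   starts at (u - 1) 2^q. *)
have [uo|ue] := boolP (odd u); last first.
  have -> : (u %/ 2 * (2 ^ q * 2) = u * 2 ^ q)%N.
    by rewrite (mulnC (2 ^ q)%N) mulnA divnK ?dvdn2.
  by rewrite r1 ler_wpDr.
have -> : (u %/ 2 * (2 ^ q * 2) = u.-1 * 2 ^ q)%N.
  rewrite (mulnC (2 ^ q)%N) mulnA; congr (_ * _)%N.
  by rewrite divn2 muln2; have := odd_double_half u; rewrite uo; lia.
have u0 : (0 < u)%N by rewrite lt0n; apply: contraTneq uo => ->.
have uT : (u.-1 < T1 * 2 ^ (K - q))%N.
  rewrite -ltnS prednK// ltnS -(leq_pmul2r (expn_gt0 2 q)) -mulnA -expnD.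
  by rewrite subnK ?(ltnW qK)// (leq_trans (leq_trunc_div _ _)).
have := dyadic_le (leq_subr q K) uT; rewrite prednK// subKn ?(ltnW qK)// => uq.
by rewrite r1 -(subrKA (x (u * 2 ^ q)%N)) (le_trans (ler_normD _ _))// lerD.
Qed.

(** 15 = 7 + 1 + 7: each end is rounded down to a multiple of 2^q, and the two multiples are equal
    or consecutive because b - a <= 2^q. *)
Lemma dyadic_increment_le q a b : (q <= K)%N -> (a <= b)%N ->
  (b <= T1 * 2 ^ K)%N -> (b <= a + 2 ^ q)%N ->
  `|x b - x a| <= 15 * B * r ^+ (K - q).
Proof.
move=> qK ab bT baq.
have Ha := dyadic_floor_le qK (leq_trans ab bT).
have Hb := dyadic_floor_le qK bT.
set u := (a %/ 2 ^ q)%N in Ha *; set v := (b %/ 2 ^ q)%N in Hb *.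
have q0 : (0 < 2 ^ q)%N by rewrite expn_gt0.
have uv : (u <= v)%N by rewrite leq_div2r.
have vu : (v <= u.+1)%N.
  by rewrite (leq_trans (leq_div2r _ baq))// divnDr ?dvdnn// divnn q0 addn1.
have BK : 0 <= B * r ^+ K by rewrite mulr_ge0 ?exprn_ge0.
have Bq : 0 <= B * r ^+ (K - q) by rewrite mulr_ge0 ?exprn_ge0.
have H : `|x (v * 2 ^ q)%N - x (u * 2 ^ q)%N| <= B * r ^+ (K - q).
  have [->|vE] : v = u \/ v = u.+1 by lia.
    by rewrite subrr normr0.
  have uT : (u < T1 * 2 ^ (K - q))%N.
    rewrite -(leq_pmul2r q0) -mulnA -expnD subnK//.
    rewrite (leq_trans _ bT)// (leq_trans _ (leq_trunc_div b (2 ^ q)))//.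
    by rewrite -/v vE.
  by have := dyadic_le (leq_subr q K) uT; rewrite subKn// vE.
move: Ha Hb H; rewrite !ler_norml => /andP[? ?] /andP[? ?] /andP[? ?].
by apply/andP; split; lra.
Qed.

(** One coordinate of [interpolate], with time counted in steps. *)
Definition linear_interp (u : R) : R :=
  let j := Num.truncn u in x j + (u - j%:R) * (x j.+1 - x j).

Lemma linear_interp_step_le u : 0 <= u -> (Num.truncn u < T1 * 2 ^ K)%N ->
  `|linear_interp u - x (Num.truncn u)| <= B * r ^+ K.
Proof.
move=> u0 uT; have /andP[ju uj] := truncn_itv u0.
have := dyadic_le (leqnn K) uT; rewrite subnn expn0 !muln1 => xu.
rewrite /linear_interp addrAC subrr add0r normrM ger0_norm ?subr_ge0//.
rewrite -[leRHS]mul1r ler_pM ?subr_ge0// lerBlDr.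
by rewrite addrC natr1 ltW.
Qed.

(** Every piece has slope at most B r^K, and points at distance at most 1 lie in the same piece or
    in consecutive ones. *)
Lemma linear_interp_lip u v : 0 <= v -> v <= u -> u - v <= 1 ->
  (Num.truncn u < T1 * 2 ^ K)%N ->
  `|linear_interp u - linear_interp v| <= B * r ^+ K * (u - v).
Proof.
move=> v0 vu uv1 uT; have u0 := le_trans v0 vu.
have /andP[ju uj] := truncn_itv u0; have /andP[jv vj] := truncn_itv v0.
have step i : (i < T1 * 2 ^ K)%N -> `|x i.+1 - x i| <= B * r ^+ K.
  by move=> iT; have := dyadic_le (leqnn K) iT; rewrite subnn expn0 !muln1.
have vT : (Num.truncn v < T1 * 2 ^ K)%N by rewrite (leq_ltn_trans _ uT)// le_truncn.
have jvu : (Num.truncn v <= Num.truncn u)%N by rewrite le_truncn.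
have juv : (Num.truncn u <= (Num.truncn v).+1)%N.
  rewrite -ltnS -(ltr_nat R) (le_lt_trans ju)// -natr1.
  by move: uv1 vj; lra.
rewrite /linear_interp.
move: (step _ uT) (step _ vT).
move: (Num.truncn u) (Num.truncn v) ju uj jv vj jvu juv.
move=> a b; rewrite -!natr1 => ju uj jv vj ba ab.
have [{ab ba}aE|{ab ba}aE] : a = b \/ a = b.+1 by lia.
  rewrite aE => xb _.
  rewrite (_ : _ - _ = (x b.+1 - x b) * (u - v)); last by ring.
  by rewrite normrM (ger0_norm (_ : 0 <= u - v)) ?subr_ge0// ler_wpM2r ?subr_ge0.
(* On consecutive pieces the increment is split at the common node b + 1. *)
move: ju uj; rewrite aE -natr1 => ju uj xa xb.
rewrite (_ : _ - _ = (x b.+2 - x b.+1) * (u - (b%:R + 1))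
   + (x b.+1 - x b) * (b%:R + 1 - v)); last by ring.
rewrite (le_trans (ler_normD _ _))// !normrM.
rewrite (ger0_norm (_ : 0 <= u - _)) ?subr_ge0//.
rewrite (ger0_norm (_ : 0 <= _ - v)) ?subr_ge0 ?(ltW vj)//.
rewrite (_ : u - v = (u - (b%:R + 1)) + (b%:R + 1 - v)); last by ring.
by rewrite [leRHS]mulrDr lerD// ler_wpM2r ?subr_ge0// ltW.
Qed.

(** For l <= K, chaining between integer times gives 15 and the two fractional ends add 1 each.
    Below one step, the slope B r^K times 2^-(l-K) is at most B r^l because 1/2 <= 7/8. *)
Lemma linear_interp_modulus l u v : 0 <= v -> v <= u ->
  (Num.truncn u < T1 * 2 ^ K)%N -> (u - v) * 2 ^+ l <= 2 ^+ K ->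
  `|linear_interp u - linear_interp v| <= 17 * B * r ^+ l.
Proof.
move=> v0 vu uT uvl; have u0 := le_trans v0 vu.
have p0 i : 0 < (2 : R) ^+ i by rewrite exprn_gt0.
have Bl i : 0 <= B * r ^+ i by rewrite mulr_ge0 ?exprn_ge0.
have vT : (Num.truncn v < T1 * 2 ^ K)%N by rewrite (leq_ltn_trans _ uT)// le_truncn.
have [lK|Kl] := leqP l K.
  have ab : (Num.truncn v <= Num.truncn u)%N by rewrite le_truncn.
  have baq : (Num.truncn u <= Num.truncn v + 2 ^ (K - l))%N.
    rewrite -ltnS -(ltr_nat R) -natr1 natrD natrX.
    have : u - v <= 2 ^+ (K - l).
      by rewrite -(ler_pM2r (p0 l)) -exprD subnK.
    have /andP[? _] := truncn_itv u0; have /andP[_] := truncn_itv v0.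
    by rewrite -natr1; lra.
  have := dyadic_increment_le (leq_subr l K) ab (ltnW uT) baq; rewrite subKn//.
  have := linear_interp_step_le u0 uT; have := linear_interp_step_le v0 vT.
  have := ler_Br lK; have := Bl l.
  rewrite !ler_norml => ? ? /andP[? ?] /andP[? ?] /andP[? ?].
  by apply/andP; split; lra.
have uv : u - v <= 2^-1 ^+ (l - K).
  rewrite exprVn -(ler_pM2r (p0 l)) (le_trans uvl)//.
  rewrite (_ : 2 ^+ l = 2 ^+ (l - K) * 2 ^+ K :> R); last first.
    by rewrite -exprD subnK// ltnW.
  by rewrite mulKf// gt_eqF.
have uv1 : u - v <= 1.
  by rewrite (le_trans uv)// exprn_ile1//; lra.
apply: (le_trans (linear_interp_lip v0 vu uv1 uT)).
apply: (@le_trans _ _ (B * r ^+ l)); last by have := Bl l; lra.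
rewrite (_ : r ^+ l = r ^+ K * r ^+ (l - K)); last by rewrite -exprD subnKC// ltnW.
rewrite mulrA ler_wpM2l//.
rewrite (le_trans uv)// lerXn2r ?nnegrE//; rewrite /r; lra.
Qed.

End Chaining.

(** * Compact sets of paths *)

Lemma fmap_ultra (A B : Type) (f : A -> B) (F : set_system A) :
  UltraFilter F -> UltraFilter (f @ F).
Proof.
move=> FU; split; first exact: fmap_proper_filter.
move=> G GF FG; rewrite eqEsubset; split=> [C GC|//].
have [//|FC] := in_ultra_setVsetC (f @^-1` C) FU.
have /filter_ex[? []//] : G (C `&` ~` C) by apply: filterI => //; exact: FG.
Qed.

(** The splitting behind the epsilon estimates for limits of paths. *)
Lemma subr_exchange (V : zmodType) (a b c d : V) :
  a - b = (c - d) + ((a - c) - (b - d)).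
Proof.
have -> : (a - c) - (b - d) = (a - b) - (c - d).
  by rewrite !opprB addrACA [RHS]addrACA (addrC (- c)).
by rewrite [RHS]addrC subrK.
Qed.

Section PathCompact.
Context (R : realType) (n : nat) (T : R).
Local Notation V := 'rV[R]_n.

(** The modulus is prescribed at the distances 2^-l only, which is the form that chaining
    produces. *)
Definition modulus_set (M : R) (w : nat -> R) : set (path_space n T) :=
  [set f | (forall t, `|f t| <= M) /\
           forall l s t, `|set_val s - set_val t| * 2 ^+ l <= 1 ->
             `|f s - f t| <= w l].

Lemma path_space_nbhs (g : path_space n T) (U : set (path_space n T)) :
  nbhs g U -> exists2 e : R, 0 < e &
    [set f : path_space n T | forall t, `|g t - f t| < e] `<=` U.
Proof.
move=> [_ [[B Bo <-]] Bg BU].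
have : nbhs (g : {uniform set_type `[0, T] -> V}) B by apply: open_nbhs_nbhs.
move=> /uniform_nbhs[E [/= entE EB]].
have [e e0 eE] : exists2 e : R, 0 < e &
    (forall u v : V, `|u - v| < e -> E (u, v)).
  move: entE; rewrite -entourage_ballE => -[e e0 eE]; exists e => // u v uv.
  by apply: eE; rewrite /= -ball_normE.
exists e => // f gf; apply: BU; apply: EB => t _; exact/eE/gf.
Qed.

(** Arzela-Ascoli by ultrafilters: an ultrafilter on the set converges pointwise since values stay
    in a compact ball, the limit inherits the bound and the modulus, and equicontinuity makes the
    convergence uniform. *)
Lemma compact_modulus_set (M : R) (w : nat -> R) :
  (forall e, 0 < e -> exists l, w l <= e) -> compact (modulus_set M w).
Proof.
move=> w0; rewrite compact_ultra => F FU FK.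
have ballM : compact [set v : V | `|v| <= M].
  apply: bounded_closed_compact.
    exists M; split; first exact: num_real.
    by move=> y My v /= /le_trans; apply; exact: ltW.
  apply: (@closed_comp _ _ (fun v : V => `|v|) [set x | x <= M]).
    by move=> v _; exact: norm_continuous.
  exact: closed_le.
have lim_at t : exists v : V, (fun f : path_space n T => f t) @ F --> v.
  move: ballM; rewrite compact_ultra => /(_ ((fun f : path_space n T => f t) @ F)).
  case.
  - exact: fmap_ultra.
  - apply: (@filterS _ F _ (modulus_set M w)) FK => f [fM _]; exact: fM.
  - by move=> v [_ ?]; exists v.
have [g gF] := choice lim_at.
have near_at t e : 0 < e -> \forall f \near F, `|g t - (f : path_space n T) t| < e.
  by move=> e0; have /cvgrPdist_lt := gF t; apply.
have gM t : `|g t| <= M.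
  apply/ler_addgt0Pr => e e0.
  have [f [[fM _] gf]] := filter_ex (filterI FK (near_at t _ e0)).
  rewrite -(subrK (f t) (g t)) (le_trans (ler_normD _ _))// addrC.
  by rewrite lerD// ltW.
have gw l s t : `|set_val s - set_val t| * 2 ^+ l <= 1 -> `|g s - g t| <= w l.
  move=> st; apply/ler_addgt0Pr => e e0.
  have e20 : 0 < e / 2 by rewrite divr_gt0.
  have [f [[_ fw] [gs gt]]] :=
    filter_ex (filterI FK (filterI (near_at s _ e20) (near_at t _ e20))).
  have -> : g s - g t = (f s - f t) + ((g s - f s) - (g t - f t)).
    exact: subr_exchange.
  rewrite (le_trans (ler_normD _ _))// lerD ?fw//.
  by rewrite (le_trans (ler_normB _ _))// (splitr e) lerD// ltW.
have gc : continuous g.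
  move=> t; apply/(cvgrPdist_le (FF := nbhs_filter t)) => e e0.
  have [l le] := w0 _ e0.
  have : \forall s \near t, `|set_val t - set_val s| < 2^-1 ^+ l.
    have : set_val @ t --> (set_val t : R) by exact: initial_continuous.
    by move=> /(cvgrPdist_lt (FF := nbhs_filter t)); apply; rewrite exprn_gt0.
  apply: (@filterS _ _ (nbhs_filter t)) => s st; apply: le_trans le; apply: gw.
  by rewrite -ler_pdivlMr ?exprn_gt0// mul1r -exprVn ltW.
pose g' : path_space n T := mkcts gc.
exists g'; split => [|U /path_space_nbhs[e e0]]; first by split.
move=> gU; apply: (@filterS _ F _ _ _ gU).
have e30 : 0 < e / 3 by rewrite divr_gt0.
have [l le] := w0 _ e30.
have l0 : 0 < (2 : R) ^+ l by rewrite exprn_gt0.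
(* Closeness is imposed on the finite grid of times i 2^-l in [0, T]; every time has a grid point
   within 2^-l to its left. *)
pose N := (Num.truncn (T * 2 ^+ l)).+1.
have : \forall f \near F, forall i : 'I_N, forall s, set_val s * 2 ^+ l = i%:R ->
    `|g s - (f : path_space n T) s| < e / 3.
  apply: filter_forall => i.
  have [[s si]|nex] :=
    pselect (exists s : set_type `[0, T], set_val s * 2 ^+ l = i%:R).
    apply: filterS (near_at s _ e30) => f gf s' s'i.
    suff -> : s' = s by [].
    apply: val_inj; apply: (mulIf (lt0r_neq0 l0)).
    by move: si s'i; rewrite !set_valE => -> ->.
  by apply: nearW => f s si; case: nex; exists s.
apply: filter_app; apply: filterS FK => f [_ fw] gf t.
have tT : 0 <= set_val t <= T.
  have : set_val t \in `[0, T]%classic by case: t => u; rewrite set_valE.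
  by rewrite inE /= in_itv.
have [t0 tT'] := andP tT.
have u0 : 0 <= set_val t * 2 ^+ l by rewrite mulr_ge0// ltW.
pose j := Num.truncn (set_val t * 2 ^+ l).
have /andP[jt tj] := truncn_itv u0.
have jN : (j < N)%N by rewrite ltnS le_truncn// ler_wpM2r// ltW.
have sP : `[0, T]%classic (j%:R / 2 ^+ l).
  rewrite /= in_itv /= divr_ge0 ?(ltW l0)//=.
  by rewrite (le_trans _ tT')// ler_pdivrMr.
pose s : set_type `[0, T] := SigSub (mem_set sP).
have sj : set_val s * 2 ^+ l = j%:R by rewrite set_valE /= divfK// gt_eqF.
have st : `|set_val t - set_val s| * 2 ^+ l <= 1.
  rewrite -(gtr0_norm l0) -normrM mulrBl sj.
  by rewrite ger0_norm ?subr_ge0// lerBlDr addrC natr1 ltW.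
(* One third of e is spent on g between t and s, one on f, and one on their distance at the grid
   time s. *)
rewrite (subr_exchange (g t) (f t) (g s) (f s)) (le_lt_trans (ler_normD _ _))//.
have gfs := gf (Ordinal jN) s sj.
have := le_trans (fw l t s st) le; have := le_trans (gw l t s st) le.
have := ler_normB (g t - g s) (f t - f s).
by move: gfs; lra.
Qed.

End PathCompact.

(** * The walk on the lattice *)

Lemma mx_norm_leP (R : realType) (n : nat) (v : 'rV[R]_n) (c : R) : 0 <= c ->
  (forall i, `|v ord0 i| <= c) <-> `|v| <= c.
Proof.
move=> c0; rewrite (_ : `|v| = mx_norm v)// mx_normrE.
split=> [vc|/bigmax_leP[_ vc] i].
  by apply/bigmax_leP; split=> // -[i j] _; rewrite /= (ord1 i).
exact: (vc (ord0, i)).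
Qed.

(** Points are coded by their integer offsets from [c], shifted by M into {0, ..., 2 M}. The centre
    is 0 for counting D_k and x for counting the neighbours of x. *)
Lemma card_lattice_box (R : realType) (n : nat) (A : set 'rV[R]_n) (c : 'rV[R]_n)
    (M : nat) (h : R) :
  (forall x, A x -> forall i, exists2 z : int, (`|z| <= M)%N &
     x ord0 i = c ord0 i + z%:~R * h) ->
  finite_set A /\ (#|` fset_set A| <= (2 * M).+1 ^ n)%N.
Proof.
move=> Ac.
pose enc (g : {ffun 'I_n -> 'I_(2 * M).+1}) : 'rV[R]_n :=
  \row_i (c ord0 i + ((g i)%:Z - M%:Z)%:~R * h).
have Aenc : A `<=` enc @` setT.
  move=> x Ax.
  have /choice[z zP] : forall i, exists z : int, (`|z| <= M)%N /\
      x ord0 i = c ord0 i + z%:~R * h.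
    by move=> i; have [z ? ?] := Ac x Ax i; exists z.
  (* The default value of [inord] never occurs, since 0 <= z i + M <= 2 M. *)
  exists [ffun i => inord (absz (z i + M%:Z)%R)] => //; apply/rowP => i.
  have [zM ->] := zP i; rewrite mxE ffunE inordK; last by lia.
  by congr (_ + _%:~R * h); lia.
have finA : finite_set A.
  by apply: (sub_finite_set Aenc); apply: finite_image; exact: finite_finset.
split=> //.
have -> : ((2 * M).+1 ^ n = #|{: {ffun 'I_n -> 'I_(2 * M).+1}}|)%N.
  by rewrite card_ffun !card_ord.
apply: (@leq_trans #|` [fset enc g | g in {: {ffun 'I_n -> 'I_(2 * M).+1}}]%fset|).
  apply: fsubset_leq_card; apply/fsubsetP => x.
  rewrite in_fset_set// inE => /Aenc[g _ <-]; apply/imfsetP.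
  by exists g.
by rewrite (leq_trans (leq_imfset_card _ _ _))// cardE.
Qed.

Section LatticeWalk.
Context (R : realType) (n : nat) (D : set 'rV[R]_n) (k : nat) (M : nat).
Local Notation V := 'rV[R]_n.
Hypothesis D_le : forall x, D x -> `|x| <= M%:R.

Lemma adjacent_coord (x y : V) i :
  Defs.adjacent k x y -> `|y ord0 i - x ord0 i| <= 2 ^- k.
Proof.
move=> <-; rewrite /enorm -sqrtr_sqr ler_sqrt ?sumr_ge0//; last first.
  by move=> *; exact: sqr_ge0.
rewrite (bigD1 i)//= !mxE -sqrrN opprB ler_wpDr// sumr_ge0// => j _.
exact: sqr_ge0.
Qed.

Lemma adjacentC (x y : V) : Defs.adjacent k x y -> Defs.adjacent k y x.
Proof.
rewrite /Defs.adjacent => <-; rewrite /enorm; congr Num.sqrt; apply: eq_bigr => i _.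
by rewrite !mxE -sqrrN opprB.
Qed.

Lemma Dlat_D x : Dlat D k x -> D x.
Proof. by move=> [/connected_component_sub[]]. Qed.

Lemma Dlat_card : finite_set (Dlat D k) /\
  (#|` fset_set (Dlat D k)| <= (2 * (M * 2 ^ k)).+1 ^ n)%N.
Proof.
apply: (@card_lattice_box _ _ _ 0 _ (2 ^- k)) => x Dx i.
have [_ /(_ i)[z xz]] := Dx; exists z; last by rewrite mxE add0r.
have /(mx_norm_leP x (ler0n _ M)) /(_ i) := D_le (Dlat_D Dx).
rewrite xz normrM (ger0_norm (_ : 0 <= 2 ^- k)) ?invr_ge0 ?exprn_ge0//.
rewrite ler_pdivrMr ?exprn_gt0// -natrX -natrM -intr_norm.
by rewrite -[(M * 2 ^ k)%:R]/((M * 2 ^ k)%:Z%:~R) ler_int; lia.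
Qed.

Lemma Dlat_finite : finite_set (Dlat D k). Proof. by case: Dlat_card. Qed.

(** A neighbour differs from x by -1, 0 or 1 lattice steps in each coordinate. The crude count 3^n
    is uniform in k. *)
Lemma neighbors_card x : lattice k x ->
  finite_set (neighbors D k x) /\ (degree D k x <= 3 ^ n)%N.
Proof.
move=> xl; apply: (@card_lattice_box _ _ _ x 1 (2 ^- k)) => y [[_ yl] xy] i.
have [z xz] := xl i; have [z' yz] := yl i.
exists (z' - z); last by rewrite xz yz intrB mulrBl addrC subrK.
have := adjacent_coord i xy; rewrite xz yz -mulrBl -intrB normrM.
rewrite (ger0_norm (_ : 0 <= 2 ^- k)) ?invr_ge0 ?exprn_ge0//.
rewrite -[leRHS]mul1r ler_pM2r ?invr_gt0 ?exprn_gt0// -intr_norm.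
by rewrite -[1]/(1%:~R) ler_int; lia.
Qed.

Lemma mk_mass_ge0 x : 0 <= mk_mass D k x.
Proof. by rewrite /mk_mass mulr_ge0// ?invr_ge0 ?exprn_ge0// divr_ge0. Qed.

Lemma step_prob_ge0 x y : 0 <= step_prob D k x y.
Proof.
by rewrite /step_prob; case: ifP => // _; case: ifP => // _; rewrite invr_ge0.
Qed.

Lemma neighbors_fin x : finite_set (neighbors D k x).
Proof. by apply: sub_finite_set Dlat_finite => y []. Qed.

Lemma neighbors_degree x y : neighbors D k x y -> degree D k x != 0.
Proof.
move=> xy; rewrite /degree cardfs_eq0; apply/eqP => N0.
have : y \in fset_set (neighbors D k x).
  by rewrite in_fset_set ?inE//; exact: neighbors_fin.
by rewrite N0 inE.
Qed.

(** The degree cancels: on D_k both sides are a constant times the indicator of adjacency, which is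
    symmetric. *)
Lemma mk_mass_rev x y : Dlat D k x -> Dlat D k y ->
  mk_mass D k x * step_prob D k x y = mk_mass D k y * step_prob D k y x.
Proof.
move=> Dx Dy.
have E u v : Dlat D k u -> Dlat D k v -> mk_mass D k u * step_prob D k u v =
    (2 * n)%:R^-1 * 2 ^- (k * n) * (`[< neighbors D k u v >])%:R.
  move=> Du Dv; rewrite /mk_mass /step_prob.
  (* At degree 0 the mass vanishes, and so does the indicator, there being no neighbour. *)
  case: eqVneq => [d0|d0].
    rewrite d0 !mul0r; case: asboolP => [/neighbors_degree|]; last by rewrite mulr0.
    by rewrite d0.
  case: asboolP => _; last by rewrite !mulr0.
  have a0 : (degree D k u)%:R != 0 :> R by rewrite pnatr_eq0.
  rewrite mulr1; move: (2 * n)%:R^-1 (2 ^- _) a0 => a b.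
  by move: (_%:R) => e e0; field.
rewrite !E//; congr (_ * _%:R); congr nat_of_bool.
by apply/asboolP/asboolP => -[_ /adjacentC ?]; split.
Qed.

Local Notation S := (fset_set (Dlat D k)).

Lemma step_prob_sum1 (x : S) : \sum_(y : S) step_prob D k (val x) (val y) = 1.
Proof.
rewrite /step_prob; case: eqVneq => [d0|d0].
  rewrite (bigD1 x)//= eqxx big1 ?addr0// => y /negPf yx.
  by rewrite (inj_eq val_inj) yx.
rewrite -(big_seq_fsetE _ S xpredT (fun y => if `[< neighbors D k (val x) y >]
  then (degree D k (val x))%:R^-1 else 0)) /=.
rewrite -big_mkcond -big_filter big_const_seq count_predT iter_addr_0.
rewrite -[_^-1]mulr1 -mulrnAr.
have -> : size [seq y <- S | `[< neighbors D k (val x) y >]] = degree D k (val x).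
  apply/perm_size/uniq_perm => [||y]; rewrite ?filter_uniq ?fset_uniq//.
  rewrite mem_filter; apply/andP/idP => [[/asboolP xy _]|].
    by rewrite in_fset_set ?inE//; exact: neighbors_fin.
  rewrite in_fset_set; last exact: neighbors_fin.
  move=> /set_mem xy; split; first exact/asboolP.
  rewrite in_fset_set; last exact: Dlat_finite.
  by apply/mem_set; case: xy.
by rewrite mulVf// pnatr_eq0.
Qed.

Lemma step_prob_coord (x y : S) i : step_prob D k (val x) (val y) != 0 ->
  `|val y ord0 i - val x ord0 i| <= 2 ^- k.
Proof.
rewrite /step_prob; case: ifP => _.
  case: (\val y =P \val x) => [->|_]; last by rewrite eqxx.
  by rewrite subrr normr0 invr_ge0 exprn_ge0.
case: asboolP => [[_ xy] _|_]; last by rewrite eqxx.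
exact: adjacent_coord.
Qed.

(** There are at most (2 M 2^k + 1)^n <= (2 M + 1)^n 2^(kn) points, of mass at most 3^n 2^-(kn)
    each, so k drops out. *)
Lemma mk_mass_sum : (0 < n)%N -> 
  \sum_(x : S) mk_mass D k (val x) <= ((2 * M).+1 ^ n * 3 ^ n)%:R.
Proof.
move=> n0; have p0 i : 0 < (2 : R) ^+ i by rewrite exprn_gt0.
apply: (@le_trans _ _ (\sum_(x : S) (3 ^ n)%:R * 2 ^- (k * n))).
  apply: ler_sum => x _; rewrite /mk_mass ler_wpM2r ?invr_ge0 ?(ltW (p0 _))//.
  have xD : Dlat D k (val x).
    by apply/set_mem; rewrite -in_fset_set ?(valP x)//; exact: Dlat_finite.
  have [_ dx] := neighbors_card xD.2.
  rewrite ler_pdivrMr ?ltr0n ?muln_gt0// -natrM ler_nat (leq_trans dx)//.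
  by rewrite leq_pmulr// muln_gt0.
rewrite sumr_const -[leLHS]mulr_natl -cardfE mulrCA natrM [leRHS]mulrC.
rewrite ler_wpM2l// ler_pdivrMr// -natrX -natrM ler_nat.
have [_ /leq_trans -> //] := Dlat_card.
rewrite expnM -expnMn leq_exp2r//.
by have : (0 < 2 ^ k)%N; rewrite ?expn_gt0//; nia.
Qed.

End LatticeWalk.

(** * Laws of the interpolated paths *)

Section ChainLaw.
Context (R : realType) (n : nat) d (Omega : measurableType d) (S : set 'rV[R]_n)
  (p : 'rV[R]_n -> 'rV[R]_n -> R) (P : 'rV[R]_n -> probability Omega R)
  (X : nat -> Omega -> 'rV[R]_n).
Hypothesis X_chain : markov_chain S p P X.
Hypothesis S_fin : finite_set S.
Local Notation St := (fset_set S).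

Definition cylinder N (s : nat -> 'rV[R]_n) : set Omega :=
  [set w | forall j, (j <= N)%N -> X j w = s j].

Lemma measurable_cylinder N s : measurable (cylinder N s).
Proof.
have -> : cylinder N s = \bigcap_(j in `I_N.+1) (X j @^-1` [set s j]).
  by apply/seteqP; split=> w h j jN; exact: h.
apply: bigcap_measurable => [|j _]; first by exists 0%N.
exact: chain_measurable X_chain j (s j).
Qed.

Lemma prob_cylinder N s x : S x ->
  P x (cylinder N s) = ((s 0%N == x)%:R * \prod_(j < N) p (s j) (s j.+1))%:E.
Proof.
move=> Sx; elim: N => [|N IH].
  have -> : cylinder 0 s = X 0%N @^-1` [set s 0%N].
    apply/seteqP; split=> w; first by move=> /(_ 0%N (leqnn _)).
    by move=> h [|//] _; exact: h.
  have Px := chain_init X_chain Sx.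
  rewrite big_ord0 mulr1; case: eqVneq => [->//|sx].
  apply/eqP; rewrite -measure_le0.
  have mx y := chain_measurable X_chain 0 y.
  (* A cylinder starting elsewhere than at x lies in the complement of an event of probability
     one. *)
  apply: (@le_trans _ _ (P x (~` (X 0%N @^-1` [set x])))).
    apply: le_measure; rewrite ?inE//; first exact: measurableC.
    by move=> w /= -> /eqP; rewrite (negPf sx).
  by rewrite probability_setC// Px subee.
rewrite /cylinder (chain_step X_chain Sx N s).
by rewrite -/(cylinder N s) IH -EFinM -mulrA; congr (_ * _)%:E; rewrite big_ord_recr.
Qed.

(** The passage from the abstract probability spaces to finite sums: an event determined by the
    positions at times 0, ..., N is a finite disjoint union of cylinders. *)
Lemma mixture_path_sum (x0 : St) (m : 'rV[R]_n -> R) N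
    (G : (nat -> 'rV[R]_n) -> Prop) :
  (forall x, 0 <= m x) ->
  (forall s s', (forall j, (j <= N)%N -> s j = s' j) -> G s -> G s') ->
  mixture S m P [set w | G (fun j => X j w)] =
  (path_sum x0 (fun x : St => m (val x)) (fun x y : St => p (val x) (val y)) N
     (fun s => (`[< G (fun j => val (s j)) >])%:R))%:E.
Proof.
move=> m0 Gext.
pose sq (t : N.+1.-tuple St) j := val (nth x0 t j).
pose GT : set (N.+1.-tuple St) := [set t | G (sq t)].
have EE : [set w | G (fun j => X j w)] = \bigcup_(t in GT) cylinder N (sq t).
  apply/seteqP; split=> w /=.
    move=> Gw.
    have St_in j : X j w \in St.
      by rewrite in_fset_set//; apply/mem_set; exact: chain_state X_chain j w.
    pose t : N.+1.-tuple St := [tuple [` St_in i]%fset | i < N.+1].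
    have tE j : (j <= N)%N -> sq t j = X j w.
      move=> jN; rewrite /sq.
      have -> : nth x0 t j = tnth t (Ordinal (jN : (j < N.+1)%N)).
        by rewrite (tnth_nth x0).
      by rewrite tnth_mktuple.
    exists t; last by move=> j /tE.
    by apply: Gext Gw => j /tE.
  by move=> [t Gt wt]; apply: Gext Gt => j jN; rewrite wt.
have PE x : S x -> P x [set w | G (fun j => X j w)] =
   (\sum_(t : N.+1.-tuple St) (`[< GT t >])%:R *
     ((sq t 0%N == x)%:R * \prod_(j < N) p (sq t j) (sq t j.+1)))%:E.
  move=> Sx; rewrite EE measure_fin_bigcup; last first.
  - by move=> t _; exact: measurable_cylinder.
  - move=> t t' _ _ [w [wt wt']]; apply/val_inj/(@eq_from_nth _ x0).
      by rewrite !size_tuple.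
    rewrite size_tuple => j jN; apply: val_inj.
    by rewrite -[LHS]wt// -[RHS]wt'.
  - exact: finite_finset.
  rewrite fsbig_finite /=; last exact: finite_finset.
  rewrite (perm_big [seq t <- index_enum _ | `[< GT t >]]) /=; last first.
    apply: uniq_perm => [||t]; [exact: fset_uniq|exact/filter_uniq/index_enum_uniq|].
    rewrite mem_filter mem_index_enum andbT.
    by rewrite in_fset_set//; exact: finite_finset.
  rewrite big_filter big_mkcond -sumEFin; apply: eq_bigr => t _.
  by case: asboolP => _; rewrite ?mul0r// mul1r prob_cylinder.
rewrite /mixture esum_fset//; last first.
  by move=> x _; rewrite mule_ge0// lee_fin.
rewrite fsbig_finite//= (big_seq_fsetE _ _ xpredT) /=.
transitivity (\sum_(x : St) (m (val x) * \sum_(t : N.+1.-tuple St) (`[< GT t >])%:R *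
     ((sq t 0%N == val x)%:R * \prod_(j < N) p (sq t j) (sq t j.+1)))%:E)%E.
  apply: eq_bigr => x _; rewrite PE ?EFinM//.
  by apply/set_mem; rewrite -in_fset_set ?(valP x).
rewrite sumEFin; congr EFin.
under eq_bigr do rewrite mulr_sumr.
rewrite exchange_big; apply: eq_bigr => t _ /=.
(* In the sum over starting points only the first point of the trajectory survives. *)
rewrite (bigD1 (nth x0 t 0))//= eqxx mul1r [X in _ + X]big1 ?addr0.
  by rewrite /path_weight mulrCA mulrC.
move=> x /negPf xt.
by rewrite /sq (inj_eq val_inj) eq_sym xt mul0r !mulr0.
Qed.

End ChainLaw.

(** * Modulus of continuity of the interpolated path *)

Section InterpolatedPath.
Context (R : realType) (n k T1 : nat) (T : R).
Local Notation V := 'rV[R]_n.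
Hypothesis TT1 : T < T1%:R.

Lemma set_val_itv (t : set_type `[0, T]) : 0 <= set_val t <= T.
Proof.
have : set_val t \in `[0, T]%classic by case: t => u; rewrite set_valE.
by rewrite inE /= in_itv.
Qed.

Lemma path_time_bound (t : set_type `[0, T]) :
  0 <= set_val t * 2 ^+ (2 * k) /\
  (Num.truncn (set_val t * 2 ^+ (2 * k)) < T1 * 2 ^ (2 * k))%N.
Proof.
have /andP[t0 tT] := set_val_itv t.
have u0 : 0 <= set_val t * 2 ^+ (2 * k) by rewrite mulr_ge0 ?exprn_ge0.
split=> //; rewrite -(ltr_nat R) natrM natrX.
have /andP[tu _] := truncn_itv u0; rewrite (le_lt_trans tu)//.
by rewrite ltr_pM2r ?exprn_gt0// (le_lt_trans tT).
Qed.

Lemma interpolate_coord (x : nat -> V) (t : R) c :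
  interpolate k x t ord0 c =
  linear_interp (fun j => x j ord0 c) (t * 2 ^+ (2 * k)).
Proof. by rewrite /interpolate /linear_interp !mxE. Qed.

(** Up to time T < T1 the interpolation reads no index beyond T1 2^(2k), so the path is a function
    of finitely many positions. *)
Lemma eq_interp_path (x x' : nat -> V) :
  (forall j, (j <= T1 * 2 ^ (2 * k))%N -> x j = x' j) ->
  interp_path k T x = interp_path k T x'.
Proof.
move=> xx'; apply/continuousEP => t; apply/rowP => c.
have [_ tN] := path_time_bound t.
rewrite [LHS]interpolate_coord [RHS]interpolate_coord /linear_interp.
by rewrite !xx'// ltnW.
Qed.

(** The library norm being the sup norm, chaining is applied to each coordinate, with K = 2 k. The
    bound 3 M comes from |x_j| + |x_(j+1) - x_j| <= M + 2 M. *)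
Lemma interp_path_modulus (M B : R) (x : nat -> V) : 0 <= B -> 0 <= M ->
  (forall j, `|x j| <= M) ->
  (forall c l i, (l <= 2 * k)%N -> (i < T1 * 2 ^ l)%N ->
    `|x (i.+1 * 2 ^ (2 * k - l))%N ord0 c - x (i * 2 ^ (2 * k - l))%N ord0 c|
      <= B * (7 / 8) ^+ l) ->
  modulus_set (3 * M) (fun l => 17 * B * (7 / 8) ^+ l) (interp_path k T x).
Proof.
move=> B0 M0 xM xosc; split=> [t|l s t].
  apply/mx_norm_leP => [|c]; first by rewrite mulr_ge0.
  rewrite [interp_path _ _ _ _ _ _]interpolate_coord /linear_interp.
  have [u0 _] := path_time_bound t.
  have /andP[] := truncn_itv u0; rewrite -natr1.
  move: (set_val t * _) => u; move: (Num.truncn u) => j ju uj.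
  have /(mx_norm_leP (x j) M0)/(_ c) := xM j.
  have /(mx_norm_leP (x j.+1) M0)/(_ c) := xM j.+1.
  move: (x j _ _) (x j.+1 _ _) => a b; rewrite !ler_norml => /andP[? ?] /andP[? ?].
  by apply/andP; split; nra.
wlog ts : s t / set_val t <= set_val s.
  move=> H; have [/H//|/ltW/H] := leP (set_val t) (set_val s).
  by rewrite distrC (distrC (interp_path _ _ _ _)); exact.
rewrite ger0_norm ?subr_ge0// => st.
have r0 : 0 <= (7 / 8 : R) by lra.
apply/mx_norm_leP => [|c]; first by rewrite !mulr_ge0 ?exprn_ge0.
have E r : (interp_path k T x : _ -> V) r ord0 c =
    linear_interp (fun j => x j ord0 c) (set_val r * 2 ^+ (2 * k)).
  exact: interpolate_coord.
rewrite mxE [X in _ + X]mxE !E.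
have [u0 uN] := path_time_bound s; have [v0 _] := path_time_bound t.
apply: (linear_interp_modulus (K := 2 * k) (T1 := T1)) => //.
- by move=> l' i l'K iT; exact: xosc.
- by rewrite ler_wpM2r ?exprn_ge0.
- by rewrite -mulrBl mulrAC ler_piMl ?exprn_ge0.
Qed.

End InterpolatedPath.

(** * Constants uniform in k, and tightness of the laws *)

Theorem lemma2p1 (R : realType) (n : nat) (n_gt0 : (0 < n)%N)
  (D : set 'rV[R]_n) (D_open : open D) (D_connected : connected D)
  (D_bounded : bounded_set D) (D_0 : D 0)
  (D_boundary : lebesgue_outer (boundary D) = 0%E)
  (d : nat -> measure_display) (Omega : forall k, measurableType (d k))
  (P : forall k, 'rV[R]_n -> probability (Omega k) R)
  (X : forall k, nat -> Omega k -> 'rV[R]_n)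
  (X_walk : forall k, (1 <= k)%N ->
     markov_chain (Dlat D k) (step_prob D k) (P k) (X k))
  (T : R) (T_gt0 : 0 < T) :
  tight [set k : nat | (1 <= k)%N]
    (fun k (A : set (path_space n T)) =>
       mixture (Dlat D k) (mk_mass D k) (P k)
         [set w | A (interp_path k T (fun j => X k j w))]).
Proof.
have [M DM] : exists M : nat, forall x, D x -> `|x| <= M%:R.
  have [M0 [_ DM0]] := D_bounded; exists (Num.truncn `|M0|).+1 => x Dx.
  apply: DM0 => //; rewrite (le_lt_trans (ler_norm _))//.
  by have /andP[] := truncn_itv (normr_ge0 M0).
pose T1 := (Num.truncn T).+1.
have TT1 : T < T1%:R by have /andP[] := truncn_itv (ltW T_gt0).
move=> eps eps0.
(* [C0] bounds the total mass of m_k for all k at once. *)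
have [C0 C0E] : exists C0 : R, C0 = ((2 * M).+1 ^ n * 3 ^ n)%:R by eexists.
have C00 : 0 <= C0 by rewrite C0E ler0n.
pose A0 : R := 1701 * n%:R * T1%:R * C0 / eps.
have A00 : 0 <= A0 by rewrite divr_ge0 ?(ltW eps0) ?mulr_ge0 ?ler0n.
(* As B >= 1, B^4 >= B >= A0, so the exceptional mass eps A0 / B^4 is at most eps. *)
pose B := 1 + A0.
have B1 : 1 <= B by rewrite lerDl.
have B0 : 0 < B by rewrite (lt_le_trans _ B1).
have B4 : 1701 * n%:R * T1%:R / B ^+ 4 * C0 <= eps.
  rewrite mulrAC ler_pdivrMr ?exprn_gt0//.
  apply: (@le_trans _ _ (eps * B)).
    by rewrite /B mulrDr mulr1 /A0 mulrCA mulfV ?gt_eqF// mulr1 ler_wpDl// ltW.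
  by rewrite ler_wpM2l ?(ltW eps0)// ler_eXnr.
exists (modulus_set (3 * M%:R) (fun l => 17 * B * (7 / 8) ^+ l)).
  apply: compact_modulus_set => e e0.
  have r1 : `|7 / 8 : R| < 1 by rewrite ger0_norm; lra.
  have /cvgrPdist_le/(_ _ e0)[N _ NP] := cvg_geometric (17 * B) r1.
  exists N; have := NP N (leqnn N); rewrite sub0r normrN.
  exact: le_trans (ler_norm _).
move=> k k1.
have finS := Dlat_finite k DM.
(* The finite sums take a point of the state space as default; on an empty one the mixture is an
   empty sum. *)
have [[x0]|noS] := pselect (exists x0 : fset_set (Dlat D k), True); last first.
  rewrite /mixture (_ : Dlat D k = set0) ?esum_set0 ?lee_fin ?ltW//.
  rewrite -subset0 => x Dx; apply: noS.
  have xS : x \in fset_set (Dlat D k) by rewrite in_fset_set// inE.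
  by exists [` xS]%fset.
move=> _.
have massge0 x := mk_mass_ge0 D k x.
rewrite (mixture_path_sum (X_walk k k1) finS x0 (N := T1 * 2 ^ (2 * k))
  (G := fun x => (~` modulus_set (3 * M%:R) (fun l => 17 * B * (7 / 8) ^+ l))
    (interp_path k T x)))//; last first.
  by move=> s s' ss'; rewrite (eq_interp_path TT1 ss').
rewrite lee_fin; apply: (le_trans _ B4).
apply: (@le_trans _ _ (1701 * n%:R * T1%:R / B ^+ 4 *
   \sum_(x : fset_set (Dlat D k)) mk_mass D k (val x))); last first.
  rewrite ler_wpM2l ?divr_ge0 ?exprn_ge0 ?mulr_ge0 ?ler0n ?(ltW B0)//.
  by rewrite C0E; exact: mk_mass_sum.
(* One unit of time is 2^(2k) steps of size at most 2^-k, whence K = 2 k and h^2 2^K = 1. *)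
apply: (@path_sum_oscillation _ _ x0 _ _ _ _ _ _ n (2 * k) T1
  (fun c (x : fset_set (Dlat D k)) => val x ord0 c) (2 ^- k)) => //.
- by move=> x y; exact: step_prob_ge0.
- by move=> x; exact: (step_prob_sum1 DM).
- move=> x y; have inD (z : fset_set (Dlat D k)) : Dlat D k (val z).
    by apply/set_mem; rewrite -in_fset_set// (valP z).
  exact: (mk_mass_rev DM (inD x) (inD y)).
- by rewrite -exprVn -exprM mulnC exprVn mulVf// expf_neq0 ?pnatr_eq0.
- by move=> c x y; exact: step_prob_coord.
(* Small dyadic increments, with the bound M on D, put the path into the compact set. *)
move=> s osc; apply/asboolPn => /=; apply.
apply: (interp_path_modulus TT1) => //; first exact: ltW.
move=> j; apply/DM/(@Dlat_D _ _ _ k)/set_mem.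
by rewrite -in_fset_set// (valP (s j)).
Qed.
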